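(* Every $[2]$-trade $T$ of volume $5$ or $6$ is equivalent to a $[2]$-trade of volume $6$ of one of the following four forms (in the group ring $\mathbb Z[2^V]$): (1) $(1-XY_1)(1-XY_2)(1-XY_3)-(1-XZ_1)(1-XZ_2)(1-XZ_3)$, where $X,Y_1,Y_2,Y_3$ are mutually disjoint, $X,Z_1,Z_2,Z_3$ are mutually disjoint, $Y_1,\dots,Z_3$ are mutually different nonempty sets, and $Y_1Y_2Y_3=Z_1Z_2Z_3$; (2) $(1-Y_1)(1-Y_2)(1-Y_3)-(1-Z_1)(1-Z_2)(1-Z_3)$, where $Y_1,Y_2,Y_3$ are mutually disjoint nonempty, $Z_1,Z_2,Z_3$ are mutually disjoint nonempty, all six sets are mutually different, and $Y_1Y_2=Z_1Z_2$; (3) $(1-Y_1)(1-Y_2)(1-Y_3)-(1-Z_1)(1-Z_2)(1-Y_1Y_2Y_3)$, where $Y_1,Y_2,Y_3,Z_1,Z_2$ are mutually disjoint nonempty sets; (4) $(\{Y_1,Y_2,Y_3,XZ_1,XZ_2,XZ_3\},\{Z_1,Z_2,Z_3,XY_1,XY_2,XY_3\})$, where $X,Y_1,Y_2,Y_3$ are mutually disjoint, $X,Z_1,Z_2,Z_3$ are mutually disjoint, $Y_1Y_2Y_3=Z_1Z_2Z_3$, $Y_i\ne Z_j$ for all $i,j$, and $X\ne\emptyset$.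
   Context: Let $V$ be a finite set. Subsets of $V$ form a group under symmetric difference $\oplus$, and we work in the group ring $\mathbb Z[(2^V,\oplus)]$: juxtaposition $XY$ of sets denotes $X\oplus Y$ and $1$ denotes the empty set. A pair $T=(T_+,T_-)$ of disjoint finite multisets of subsets (blocks) is identified with $\sum_X\tau_X X$, where $\tau_X$ is the multiplicity of $X$ in $T_+$, or minus its multiplicity in $T_-$. $T$ is a $[t]$-trade if for each $i\le t$ every $i$-subset of $V$ lies in equally many blocks of $T_+$ as of $T_-$; its volume is $|T_+|=|T_-|$. For $Y\subseteq V$ the $Y$-shift of $T$ is $YT$ (every block $B$ replaced by $Y\oplus B$). Two trades are equivalent if one is obtained from the other by a permutation of the elements of $V$, shifts, and optionally swapping the two legs $T_+$ and $T_-$. *)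

(* Defs.v *)
From HB Require Import structures.
From mathcomp Require Import all_boot all_order all_algebra all_fingroup.
From mathcomp Require Export finmap multiset.

Set Implicit Arguments.
Unset Strict Implicit.
Unset Printing Implicit Defensive.

Import GRing.Theory.
Local Open Scope ring_scope.
Local Open Scope mset_scope.

Section SymmetricDifference.
Variable V : finType.
Implicit Types A B C : {set V}.

Definition symdiff A B : {set V} := (A :\: B) :|: (B :\: A).

Lemma in_symdiff x A B : (x \in symdiff A B) = (x \in A) (+) (x \in B).
Proof. by rewrite !inE; do 2!case: (_ \in _). Qed.

Lemma symdiffC : commutative symdiff.
Proof. by move=> A B; apply/setP=> x; rewrite !in_symdiff addbC. Qed.

Lemma symdiffA : associative symdiff.
Proof. by move=> A B C; apply/setP=> x; rewrite !in_symdiff addbA. Qed.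

Lemma symdiff0l : left_id set0 symdiff.
Proof. by move=> A; apply/setP=> x; rewrite in_symdiff inE. Qed.

Lemma symdiffvv A : symdiff A A = set0.
Proof. by apply/setP=> x; rewrite in_symdiff addbb inE. Qed.

Lemma symdiffKl A : involutive (symdiff A).
Proof. by move=> B; rewrite symdiffA symdiffvv symdiff0l. Qed.

End SymmetricDifference.

Notation "A :+: B" := (symdiff A B) (at level 52, left associativity) : set_scope.

(* The group ring Z[(2^V, :+:)].  Its product is convolution, so it must be
   an alias distinct from {ffun {set V} -> int}, whose canonical ring product
   is pointwise. *)
Definition gring (V : finType) : Type := {ffun {set V} -> int}.

HB.instance Definition _ (V : finType) :=
  GRing.Zmodule.copy (gring V) {ffun {set V} -> int}.

Section GroupRing.
Variable V : finType.
Implicit Types (A B : {set V}) (f g h : gring V).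

Definition gset A : gring V := [ffun B => (B == A)%:R].

Definition gring_mul f g : gring V :=
  [ffun C : {set V} => \sum_(A : {set V}) f A * g (A :+: C)].

Lemma gring_mulC : commutative gring_mul.
Proof.
move=> f g; apply/ffunP=> C; rewrite !ffunE.
have bij : {on [pred _ | true], bijective (fun A : {set V} => A :+: C)}.
  by apply: onW_bij; exists (fun A => A :+: C) => A /=;
    rewrite -symdiffA symdiffvv symdiffC symdiff0l.
rewrite (reindex _ bij); apply: eq_bigr => A _.
by rewrite -symdiffA symdiffvv [A :+: set0]symdiffC symdiff0l mulrC.
Qed.

Lemma gring_mulA : associative gring_mul.
Proof.
move=> f g h; apply/ffunP=> C; rewrite !ffunE.
under eq_bigr => A _ do rewrite ffunE mulr_sumr.
under [RHS]eq_bigr => A _ do rewrite ffunE mulr_suml.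
rewrite [RHS]exchange_big; apply: eq_bigr => A _ /=.
have bij : {on [pred _ | true], bijective (fun B : {set V} => A :+: B)}.
  by apply: onW_bij; exists (fun B => A :+: B); apply: symdiffKl.
rewrite [RHS](reindex _ bij); apply: eq_bigr => B _ /=.
by rewrite symdiffKl mulrA [A :+: B]symdiffC symdiffA.
Qed.

Lemma gring_mul1 : left_id (gset set0) gring_mul.
Proof.
move=> f; apply/ffunP=> C; rewrite ffunE (bigD1 set0) //= ffunE eqxx mul1r.
rewrite symdiff0l big1 ?addr0 // => A /negbTE nA0.
by rewrite ffunE nA0 mul0r.
Qed.

Lemma gring_mulDl : left_distributive gring_mul +%R.
Proof.
move=> f g h; apply/ffunP=> C; rewrite !ffunE -big_split /=.
by apply: eq_bigr => A _; rewrite ffunE mulrDl.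
Qed.

Lemma gring_1neq0 : gset set0 != 0 :> gring V.
Proof. by apply/eqP=> /ffunP /(_ set0); rewrite !ffunE eqxx. Qed.

HB.instance Definition _ := GRing.Zmodule_isComNzRing.Build (gring V)
  gring_mulA gring_mulC gring_mul1 gring_mulDl gring_1neq0.

Lemma gset0 : gset set0 = 1. Proof. by []. Qed.

Lemma gsetM A B : gset A * gset B = gset (A :+: B).
Proof.
apply/ffunP=> C; rewrite [LHS]ffunE (bigD1 A) //= !ffunE eqxx mul1r.
rewrite big1 ?addr0 => [|D /negbTE nDA]; last by rewrite ffunE nDA mul0r.
by rewrite (can2_eq (symdiffKl A) (symdiffKl A)).
Qed.

End GroupRing.

Section Trades.
Variable V : finType.

(* T.1 is T_+ and T.2 is T_-. *)
Definition legs : Type := ({mset {set V}} * {mset {set V}})%type.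

Implicit Types (T : legs) (A B X Y Z : {set V}).

Definition is_trade (t : nat) T : Prop :=
  mdisjoint T.1 T.2 /\
  forall i : nat, (i <= t)%N -> forall A, #|A| = i ->
    count (fun B => A \subset B) T.1 = count (fun B => A \subset B) T.2.

(* For a [t]-trade this is also size T.2, by the condition with i = 0. *)
Definition volume T : nat := size T.1.

Definition gring_of T : gring V :=
  \sum_(X : {set V}) gset X *~ ((T.1 X)%:Z - (T.2 X)%:Z).

Definition map_blocks (phi : {set V} -> {set V}) T : legs :=
  (seq_mset (map phi T.1), seq_mset (map phi T.2)).

Definition shift Y T : legs := map_blocks (symdiff Y) T.

Definition permute (s : {perm V}) T : legs :=
  map_blocks (fun B => [set s x | x in B]) T.

Definition swap T : legs := (T.2, T.1).

Inductive equivalent : legs -> legs -> Prop :=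
| equivalent_refl T : equivalent T T
| equivalent_permute s T : equivalent T (permute s T)
| equivalent_shift Y T : equivalent T (shift Y T)
| equivalent_swap T : equivalent T (swap T)
| equivalent_trans T1 T2 T3 :
    equivalent T1 T2 -> equivalent T2 T3 -> equivalent T1 T3.

(* Compares entries at distinct positions, so repeated empty sets are
   allowed. *)
Definition mutually_disjoint (s : seq {set V}) : bool :=
  pairwise (fun A B => [disjoint A & B]) s.

Definition nonempty_sets (s : seq {set V}) : bool := set0 \notin s.

Definition form1 T : Prop :=
  exists X Y1 Y2 Y3 Z1 Z2 Z3 : {set V},
    [/\ mutually_disjoint [:: X; Y1; Y2; Y3],
        mutually_disjoint [:: X; Z1; Z2; Z3],
        uniq [:: Y1; Y2; Y3; Z1; Z2; Z3],
        nonempty_sets [:: Y1; Y2; Y3; Z1; Z2; Z3] &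
        Y1 :+: Y2 :+: Y3 = Z1 :+: Z2 :+: Z3] /\
    gring_of T =
      (1 - gset (X :+: Y1)) * (1 - gset (X :+: Y2)) * (1 - gset (X :+: Y3))
      - (1 - gset (X :+: Z1)) * (1 - gset (X :+: Z2)) * (1 - gset (X :+: Z3)).

Definition form2 T : Prop :=
  exists Y1 Y2 Y3 Z1 Z2 Z3 : {set V},
    [/\ mutually_disjoint [:: Y1; Y2; Y3],
        mutually_disjoint [:: Z1; Z2; Z3],
        nonempty_sets [:: Y1; Y2; Y3; Z1; Z2; Z3],
        uniq [:: Y1; Y2; Y3; Z1; Z2; Z3] &
        Y1 :+: Y2 = Z1 :+: Z2] /\
    gring_of T =
      (1 - gset Y1) * (1 - gset Y2) * (1 - gset Y3)
      - (1 - gset Z1) * (1 - gset Z2) * (1 - gset Z3).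

Definition form3 T : Prop :=
  exists Y1 Y2 Y3 Z1 Z2 : {set V},
    [/\ mutually_disjoint [:: Y1; Y2; Y3; Z1; Z2],
        nonempty_sets [:: Y1; Y2; Y3; Z1; Z2] &
        gring_of T =
          (1 - gset Y1) * (1 - gset Y2) * (1 - gset Y3)
          - (1 - gset Z1) * (1 - gset Z2) * (1 - gset (Y1 :+: Y2 :+: Y3))].

Definition form4 T : Prop :=
  exists X Y1 Y2 Y3 Z1 Z2 Z3 : {set V},
    [/\ mutually_disjoint [:: X; Y1; Y2; Y3],
        mutually_disjoint [:: X; Z1; Z2; Z3],
        Y1 :+: Y2 :+: Y3 = Z1 :+: Z2 :+: Z3,
        {in [:: Y1; Y2; Y3] & [:: Z1; Z2; Z3], forall Y Z, Y <> Z} &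
        X <> set0] /\
    T = (seq_mset [:: Y1; Y2; Y3; X :+: Z1; X :+: Z2; X :+: Z3],
         seq_mset [:: Z1; Z2; Z3; X :+: Y1; X :+: Y2; X :+: Y3]).

End Trades.

(* Main.v *)
(* Write the legs of a trade as lists p, q of n blocks and call the pair of
   incidence vectors of a point v in p and in q the column of v.  A pair (p, q)
   is a [2]-trade iff any two columns (a, b), (c, d) satisfy |a & c| = |b & d|
   and every row of p is separated from every row of q by some column.
   Shifts complement columns, so only the set of columns up to complement and
   up to permutations of the rows of p and of q matters.  A search by computation
   adds one column at a time, each time a column separating a pair of rows
   that are still equal, and keeps one representative per row permutation.
   It shows that n = 5 is impossible and that for n = 6 all columns belong,
   up to complement, to one of four maximal families, one for each form. *)

Require Import Defs.
From mathcomp Require Import all_boot all_order all_algebra all_fingroup.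
From mathcomp Require Import ring zify.

Set Implicit Arguments.
Unset Strict Implicit.
Unset Printing Implicit Defensive.

Import GRing.Theory.

(** * Families of columns and their enumeration *)

Definition column : Type := (bitseq * bitseq)%type.

Definition overlap (x y : bitseq) := count (fun b => b.1 && b.2) (zip x y).
(** On the diagonal c = d this equates the weights of the two halves, which is the trade condition
    on single points. *)
Definition balanced (c d : column) := overlap c.1 d.1 == overlap c.2 d.2.
Definition compl (c : column) : column := (map negb c.1, map negb c.2).
Definition reorder (s : seq nat) (x : bitseq) := [seq nth false x i | i <- s].
Definition relabel (s t : seq nat) (c : column) : column :=
  (reorder s c.1, reorder t c.2).
Definition closure (U : seq column) := U ++ map compl U.
Definition zero n : column := (nseq n false, nseq n false).

Definition lefts (D : seq column) := [seq c.1 | c <- D].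
Definition rights (D : seq column) := [seq c.2 | c <- D].
Definition row (xs : seq bitseq) (i : nat) : bitseq :=
  [seq nth false x i | x <- xs].

(* Radix sort of the rows, decreasing in the lexicographic order. *)
Definition row_order n (xs : seq bitseq) : seq nat :=
  foldr (fun x s => [seq i <- s | nth false x i]
                      ++ [seq i <- s | ~~ nth false x i]) (iota 0 n) xs.

(** Permuting the rows of a leg keeps their multiset, so sorting gives the same result for all row
    permutations of [D]. Soundness only uses that it is a relabelling. *)
Definition canon n (D : seq column) : seq column :=
  map (relabel (row_order n (lefts D)) (row_order n (rights D))) D.

Fixpoint bitseqs n : seq bitseq :=
  if n is m.+1
  then map (cons true) (bitseqs m) ++ map (cons false) (bitseqs m)
  else [:: [::]].

(* Chooses one column out of each pair of complementary ones. *)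
Definition light n (c : column) : bool :=
  let k := (count id c.1).*2 in (k < n) || (k == n) && head true c.1.

Definition columns n : seq column :=
  [seq c <- [seq (x, y) | x <- bitseqs n, y <- bitseqs n]
     | light n c && (count id c.1 == count id c.2)].

(* The virtual machine evaluates both arguments of [&&] and [||], so the
   searches below branch with [if] and use this variant of [has]. *)
Fixpoint lazy_has (T : Type) (p : pred T) (s : seq T) : bool :=
  if s is x :: s' then if p x then true else lazy_has p s' else false.

(** When both lists have the same distinct rows, this permutation carries [xs] to [ys]; otherwise an
    entry repeats or equals [n], and [embeds] rejects it. *)
Definition match_rows n (xs ys : seq bitseq) : seq nat :=
  [seq index (row ys i) (map (row xs) (iota 0 n)) | i <- iota 0 n].

(* Looks for columns in [A] that become the frame [F] after a reordering of
   the rows that puts [B] inside the closure of [U]. *)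
Fixpoint embeds n (U F found todo A B : seq column) : bool :=
  if todo is _ :: todo' then
    lazy_has (fun c =>
      if canon n (rcons found c) == canon n (take (size found).+1 F)
      then embeds n U F (rcons found c) todo' A B else false) A
  else
    let s := match_rows n (lefts found) (lefts F) in
    let t := match_rows n (rights found) (rights F) in
    [&& perm_eq s (iota 0 n), perm_eq t (iota 0 n)
      & all (fun c => relabel s t c \in closure U) B].

Definition even_column (c : column) : bool := ~~ odd (count id c.1).

(** Size and number of even columns are cheap invariants that discard wrong targets early. The frame
    skips the zero column heading each target. *)
Definition fits n (targets : seq (seq column)) (B : seq column) : bool :=
  lazy_has (fun U =>
    if (size B == size U) && (count even_column B == count even_column U)
    then let F := take 5 (behead U) in embeds n U F [::] F (closure B) B
    else false) targets.

Definition unseparated n (D : seq column) : seq (nat * nat) :=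
  [seq r <- [seq (i, j) | i <- iota 0 n, j <- iota 0 n]
     | row (lefts D) r.1 == row (rights D) r.2].

(** Running out of the depth [k] counts as failure, so [true] is conclusive. Once all rows are
    separated, either the admissible columns together fit a target or each remaining one is
    tried. *)
Fixpoint search k n (targets : seq (seq column)) (cols D : seq column) :=
  if k is k'.+1 then
    let A := [seq c <- cols | all (balanced c) D] in
    let explore B := all (search k' n targets cols)
                         (undup [seq canon n (rcons D c) | c <- B]) in
    if unseparated n D is (i, j) :: _ then
      explore [seq c <- A | nth false c.1 i != nth false c.2 j]
    else if fits n targets A then true
    else let B := [seq c <- A | (c \notin D) && (compl c \notin D)] in
      (B != [::]) && explore B
  else false.

(** Closure under complement lets the search try one column of each complementary pair; separation
    says that no block lies in both legs. *)
Record is_family n (C : seq column) : Prop := IsFamily {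
  family_size : {in C, forall c, size c.1 = n /\ size c.2 = n};
  family_balanced : {in C &, forall c d, balanced c d};
  family_compl : {in C, forall c, compl c \in C};
  family_separated : forall i j, i < n -> j < n ->
    exists2 c, c \in C & nth false c.1 i != nth false c.2 j
}.

Definition embeddable n (targets : seq (seq column)) (C : seq column) : Prop :=
  exists s t U, [/\ perm_eq s (iota 0 n), perm_eq t (iota 0 n), U \in targets
                  & {in C, forall c, relabel s t c \in closure U}].

(** * Overlaps, complements and reorderings of columns *)

Lemma lazy_hasE (T : Type) (p : pred T) s : lazy_has p s = has p s.
Proof. by elim: s => //= x s ->; case: (p x). Qed.

Lemma complK : involutive compl.
Proof.
by case=> x y; rewrite /compl /=; congr (_, _); apply/(mapK negbK).
Qed.

Lemma closure_compl U c : (compl c \in closure U) = (c \in closure U).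
Proof.
rewrite /closure !mem_cat (mem_map (inv_inj complK)) orbC.
by rewrite -{4}[c]complK (mem_map (inv_inj complK)).
Qed.

Lemma mem_bitseqs n x : (x \in bitseqs n) = (size x == n).
Proof.
elim: n x => [|n IHn] [|b x] //=; rewrite mem_cat.
  by apply/norP; split; apply/mapP=> -[].
rewrite eqSS -IHn; apply/orP/idP => [[]/mapP[y yn [_ ->]] //|xn].
by case: b; [left|right]; apply: map_f.
Qed.

Lemma overlap_map (T : Type) (f g : pred T) s :
  overlap (map f s) (map g s) = count (fun i => f i && g i) s.
Proof. by elim: s => //= i s IHs; rewrite /overlap /= -IHs. Qed.

Lemma overlapC : commutative overlap.
Proof.
by rewrite /overlap; elim=> [|a x IHx] [|b y] //=; rewrite IHx andbC.
Qed.

Lemma overlapxx x : overlap x x = count id x.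
Proof. by rewrite /overlap; elim: x => //= a x ->; rewrite andbb. Qed.

Lemma overlap_neg x y : size x = size y ->
  overlap x (map negb y) + overlap x y = count id x.
Proof.
rewrite /overlap; elim: x y => [|a x IHx] [|b y] //= [] /IHx <-.
by rewrite addnACA; case: a b => [] [].
Qed.

Lemma balancedC c d : balanced c d = balanced d c.
Proof. by rewrite /balanced overlapC [overlap c.2 _]overlapC. Qed.

(** Complementing d turns an overlap into the weight of c minus that overlap, and [balanced c c]
    equates the two weights of c. *)
Lemma balanced_compl c d : size c.1 = size d.1 -> size c.2 = size d.2 ->
  balanced c c -> balanced c d -> balanced c (compl d).
Proof.
rewrite /balanced !overlapxx /= => s1 s2 /eqP cc /eqP cd; apply/eqP.
by apply: (@addIn (overlap c.1 d.1)); rewrite {2}cd !overlap_neg.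
Qed.

Lemma perm_iota_lt n s i : perm_eq s (iota 0 n) -> i \in s -> i < n.
Proof. by move=> /perm_mem ->; rewrite mem_iota. Qed.

Lemma perm_iota_size n s : perm_eq s (iota 0 n) -> size s = n.
Proof. by move/perm_size; rewrite size_iota. Qed.

Lemma perm_row_order n xs : perm_eq (row_order n xs) (iota 0 n).
Proof. by elim: xs => //= x xs IHxs; rewrite perm_filterC. Qed.

Lemma overlap_reorder n s x y : perm_eq s (iota 0 n) ->
  size x = n -> size y = n ->
  overlap (reorder s x) (reorder s y) = overlap x y.
Proof.
move=> sP xn yn; rewrite overlap_map (seq.permP sP).
have idE z : size z = n -> z = [seq nth false z i | i <- iota 0 n].
  by move=> <-; rewrite [RHS]mkseq_nth.
by rewrite [in RHS](idE x) // [in RHS](idE y) // overlap_map.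
Qed.

Lemma reorder_neg n s x : perm_eq s (iota 0 n) -> size x = n ->
  reorder s (map negb x) = map negb (reorder s x).
Proof.
move=> sP xn; rewrite /reorder -map_comp; apply/eq_in_map => i.
by move=> /(perm_iota_lt sP) ilt /=; rewrite (nth_map false) ?xn.
Qed.

Lemma reorder_comp n s s' x : perm_eq s (iota 0 n) -> perm_eq s' (iota 0 n) ->
  reorder s' (reorder s x) = reorder [seq nth 0 s i | i <- s'] x.
Proof.
move=> sP s'P; rewrite [RHS]/reorder -map_comp; apply/eq_in_map => i.
move=> /(perm_iota_lt s'P) ilt /=.
by rewrite (nth_map 0) // (perm_iota_size sP).
Qed.

Lemma perm_comp n s s' : perm_eq s (iota 0 n) -> perm_eq s' (iota 0 n) ->
  perm_eq [seq nth 0 s i | i <- s'] (iota 0 n).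
Proof.
move=> sP s'P; apply: perm_trans (sP); apply: perm_trans (perm_map _ s'P) _.
by rewrite -(perm_iota_size sP) -/(mkseq _ _) mkseq_nth.
Qed.

Section Relabel.
Variables (n : nat) (s t : seq nat).
Hypotheses (sP : perm_eq s (iota 0 n)) (tP : perm_eq t (iota 0 n)).

Lemma relabel_compl c : size c.1 = n -> size c.2 = n ->
  relabel s t (compl c) = compl (relabel s t c).
Proof. by move=> c1 c2; rewrite /relabel !(@reorder_neg n). Qed.

Lemma relabel_family C : is_family n C -> is_family n (map (relabel s t) C).
Proof.
case=> sz bal cpl sep; split.
- move=> _ /mapP[c _ ->].
  by rewrite !size_map (perm_iota_size sP) (perm_iota_size tP).
- move=> _ _ /mapP[c cC ->] /mapP[d dC ->].
  have [[c1 c2] [d1 d2]] := (sz c cC, sz d dC).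
  by rewrite /balanced !(@overlap_reorder n) //; apply: bal.
- move=> _ /mapP[c cC ->]; have [c1 c2] := sz c cC.
  by rewrite -relabel_compl //; apply/map_f/cpl.
- move=> i j ilt jlt; rewrite -(perm_iota_size sP) in ilt.
  rewrite -(perm_iota_size tP) in jlt.
  have [] := sep (nth 0 s i) (nth 0 t j).
  + exact/(perm_iota_lt sP)/mem_nth.
  + exact/(perm_iota_lt tP)/mem_nth.
  move=> c cC cij; exists (relabel s t c); first exact: map_f.
  by rewrite !(nth_map 0).
Qed.

Lemma relabel_embeddable targets C :
  embeddable n targets (map (relabel s t) C) -> embeddable n targets C.
Proof.
case=> s' [t' [U [s'P t'P UT CU]]].
exists [seq nth 0 s i | i <- s'], [seq nth 0 t i | i <- t'], U.
split=> // [||c cC]; try exact: perm_comp.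
rewrite /relabel -(reorder_comp _ sP) // -(reorder_comp _ tP) //.
exact: CU (map_f _ cC).
Qed.

End Relabel.

(** * Soundness of the search *)

Lemma mem_columns n c : size c.1 = n -> size c.2 = n -> balanced c c ->
  (c \in columns n) || (compl c \in columns n).
Proof.
have mem x y : size x = n -> size y = n -> count id x = count id y ->
    ((x, y) \in columns n) = light n (x, y).
  move=> xn yn xy; rewrite mem_filter /= xy eqxx andbT.
  by rewrite (allpairs_f pair) ?andbT // mem_bitseqs ?xn ?yn.
case: c => x y /= xn yn; rewrite /balanced !overlapxx => /eqP /= xy.
have neg z : size z = n -> count id (map negb z) + count id z = n.
  by move=> <-; rewrite count_map addnC -(count_predC id z).
rewrite mem // mem ?size_map //; last first.
  by apply: (@addIn (count id x)); rewrite {2}xy !neg.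
(* Of the complementary weights the smaller makes its column light; if they are equal, the first
   entry decides. *)
rewrite /light /=; move: (neg x xn).
case: x xn {xy mem neg} => [|a x] /=; first by move=> <-.
by case: a => /= xn; lia.
Qed.

(** The comparisons of canonical forms only prune: the final test alone certifies the permutations
    and the inclusion. *)
Lemma embeds_sound n U F found todo A B : embeds n U F found todo A B ->
  exists s t, [/\ perm_eq s (iota 0 n), perm_eq t (iota 0 n)
                & {in B, forall c, relabel s t c \in closure U}].
Proof.
elim: todo found => [|f todo IHtodo] found /=.
  case/and3P=> sP tP /allP BU.
  by exists (match_rows n (lefts found) (lefts F)),
            (match_rows n (rights found) (rights F)).
rewrite lazy_hasE => /hasP[c _]; case: ifP => // _; exact: IHtodo.
Qed.

Lemma fits_sound n targets B : fits n targets B ->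
  exists s t U, [/\ perm_eq s (iota 0 n), perm_eq t (iota 0 n), U \in targets
                  & {in B, forall c, relabel s t c \in closure U}].
Proof.
rewrite /fits lazy_hasE => /hasP[U UT]; case: ifP => // _.
by case/embeds_sound=> s [t [sP tP BU]]; exists s, t, U.
Qed.

Lemma embeddable_sub n targets C C' : {subset C <= C'} ->
  embeddable n targets C' -> embeddable n targets C.
Proof.
move=> CC' [s [t [U [sP tP UT CU]]]]; exists s, t, U; split=> // c /CC'.
exact: CU.
Qed.

Lemma closure_family n (L : seq column) :
  {in L, forall c, size c.1 = n /\ size c.2 = n} ->
  {in L &, forall c d, balanced c d} ->
  (forall i j, i < n -> j < n ->
    exists2 c, c \in L & nth false c.1 i != nth false c.2 j) ->
  is_family n (closure L).
Proof.
move=> sz bal sep.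
have clP c : c \in closure L -> c \in L \/ exists2 d, d \in L & c = compl d.
  by rewrite mem_cat => /orP[|/mapP]; [left | right].
have balc c d : c \in L -> d \in L -> balanced c (compl d).
  move=> cL dL; have [[c1 c2] [d1 d2]] := (sz c cL, sz d dL).
  by apply: balanced_compl; rewrite ?bal ?c1 ?c2.
have balcc c d : c \in L -> d \in L -> balanced (compl c) (compl d).
  move=> cL dL; have [[c1 c2] [d1 d2]] := (sz c cL, sz d dL).
  apply: balanced_compl; rewrite ?size_map ?c1 ?c2 //; last first.
    by rewrite balancedC balc.
  have := bal c c cL cL; rewrite /balanced !overlapxx !count_map => /eqP cw.
  have := count_predC id c.1; rewrite c1 -c2 -(count_predC id c.2) cw.
  by move/addnI/eqP.
split.
- by move=> c /clP[/sz//|[d /sz dn ->]]; rewrite !size_map.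
- move=> c d /clP[cL|[c' cL ->]] /clP[dL|[d' dL ->]].
  + exact: bal.
  + exact: balc.
  + by rewrite balancedC balc.
  + exact: balcc.
- by move=> c; rewrite closure_compl.
- move=> i j ilt jlt; have [c cL cij] := sep i j ilt jlt.
  by exists c; rewrite // mem_cat cL.
Qed.

(** Induction on the depth with C general: C is relabelled along with D at every canonical form, and
    it may be enlarged at a leaf. *)
Lemma search_sound k n targets D C : search k n targets (columns n) D ->
  is_family n C -> {subset D <= C} -> embeddable n targets C.
Proof.
elim: k D C => //= k IHk D C; set A := [seq c <- columns n | _].
have explore B c C' : is_family n C' -> {subset D <= C'} ->
    all (search k n targets (columns n)) (undup [seq canon n (rcons D c) | c <- B]) ->
    c \in B -> c \in C' -> embeddable n targets C'.
  move=> famC' DC' /allP srch cB cC'.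
  have sP := perm_row_order n (lefts (rcons D c)).
  have tP := perm_row_order n (rights (rcons D c)).
  apply: (relabel_embeddable sP tP).
  apply: IHk (relabel_family sP tP famC') _.
    by apply: srch; rewrite mem_undup; apply: map_f cB.
  move=> _ /mapP[d dD ->]; apply: map_f.
  by move: dD; rewrite mem_rcons inE => /predU1P[->|/DC'].
move=> srch famC DC; have [sz bal cpl sep] := famC.
have AC c : c \in C -> (c \in A) || (compl c \in A).
  move=> cC; have [c1 c2] := sz c cC; have cC' := cpl c cC.
  have := mem_columns c1 c2 (bal c c cC cC); rewrite !mem_filter.
  rewrite (_ : all (balanced c) D); last first.
    by apply/allP=> d /DC dC; apply: bal.
  by rewrite (_ : all (balanced (compl c)) D) //;
    apply/allP=> d /DC dC; apply: bal.
case unsepE: (unseparated n D) srch => [|[i j] r] srch; last first.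
  have: (i, j) \in unseparated n D by rewrite unsepE mem_head.
  rewrite mem_filter => /andP[_ /allpairsP[[i' j'] /=]].
  rewrite !mem_iota /= => -[ilt jlt [ei ej]]; subst i' j'.
  have [c cC cij] := sep i j ilt jlt; have [c1 c2] := sz c cC.
  (* The complement of a separating column separates the same pair, so it does not matter which of
     the two is in A. *)
  have /orP[cA|cA] := AC c cC.
    by apply: (explore _ c) srch _ cC; rewrite // mem_filter cij.
  apply: (explore _ (compl c)) srch _ (cpl c cC); rewrite // mem_filter cA.
  by rewrite !(nth_map false) ?c1 ?c2 // (inj_eq negb_inj) cij.
case: ifP srch => [/fits_sound[s [t [U [sP tP UT AU]]]] _|_ /andP[Bn0 srch]].
  exists s, t, U; split=> // c cC; have [c1 c2] := sz c cC.
  have /orP[/AU//|/AU] := AC c cC.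
  by rewrite (relabel_compl sP tP) // closure_compl.
set B := [seq c <- A | _] in Bn0 srch.
have [/hasP[c cB cC]|/hasPn BC] := boolP (has (mem C) B).
  exact: (explore B c).
have CD c : c \in C -> (c \in D) || (compl c \in D).
  move=> cC; apply: contraT => /norP[cD c'D]; have /orP[cA|cA] := AC c cC.
    by have /BC/negP[] : c \in B by rewrite mem_filter cD c'D.
  have /BC/negP[] : compl c \in B by rewrite mem_filter complK cD c'D.
  exact: cpl.
(* Here C consists of the columns of D and their complements, and every
   column of B can be added to it. *)
case BE: B Bn0 srch => [//|c B'] _ srch.
have: c \in B by rewrite BE mem_head.
rewrite !mem_filter /= => /andP[_ /andP[/allP cD /andP[/andP[_ /eqP cw]]]].
case/allpairsP=> -[x y]; rewrite /= !mem_bitseqs => -[/eqP xn /eqP yn cE].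
have [c1 c2] : size c.1 = n /\ size c.2 = n by rewrite cE.
have cc : balanced c c by rewrite /balanced !overlapxx cw.
have CC : {subset C <= closure (c :: C)}.
  by move=> d dC; rewrite mem_cat inE dC orbT.
(* The branch of c is applied to C enlarged by c, which is still separated; its embedding restricts
   to C. *)
apply: (embeddable_sub CC); apply: (explore _ c) srch _ _.
- have cC : {in C, forall d, balanced c d}.
    move=> d dC; have [d1 d2] := sz d dC.
    have /orP[/cD//|/cD cd'] := CD d dC.
    by rewrite -[d]complK; apply: balanced_compl; rewrite // size_map ?c1 ?c2.
  apply: closure_family => [d|d e|i j ilt jlt].
  + by rewrite inE => /predU1P[->|/sz].
  + rewrite !inE => /predU1P[->|dC] /predU1P[->|eC] //.
    * exact: cC.
    * by rewrite balancedC cC.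
    * exact: bal.
  + by have [d dC dij] := sep i j ilt jlt; exists d; rewrite // inE dC orbT.
- by move=> d /DC/CC.
- exact: mem_head.
- by rewrite mem_cat mem_head.
Qed.

(** * The four maximal families *)

Definition indicator (s : seq nat) : bitseq := [seq i \in s | i <- iota 0 6].

(** Among sequences of weight three this picks one of each complementary pair; for weight two it
    means one entry in each half. *)
Definition crossing (x : bitseq) : bool := odd (count id (take 3 x)).

(* Rows X Z1, X Z2, X Z3, Y2 Y3, Y1 Y3, Y1 Y2
   and Z2 Z3, Z1 Z3, Z1 Z2, X Y1, X Y2, X Y3. *)
Definition splits1 : seq column :=
  [seq (x, map negb x) | x <- bitseqs 6 & (count id x == 3) && crossing x].

(** As [bitseqs] lists [true] first, the head is 111000 paired with 000111, the column of the points
    of X. *)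
Definition column_X : column := head (zero 6) splits1.

Definition family1 : seq column := zero 6 :: splits1.

(* Rows Y1 Y3, Y2 Y3, Z1, Z2, Z3, Z1 Z2 Z3
   and Y1, Y2, Y3, Y1 Y2 Y3, Z1 Z3, Z2 Z3. *)
Definition family2 : seq column :=
  zero 6 :: [seq (indicator c.1, indicator c.2) | c <-
    [:: ([:: 0; 1], [:: 2; 3]);
        ([:: 4; 5], [:: 4; 5]);
        ([:: 0; 2; 5], [:: 0; 3; 4]);
        ([:: 0; 3; 5], [:: 0; 3; 5]);
        ([:: 1; 2; 5], [:: 1; 3; 4]);
        ([:: 1; 3; 5], [:: 1; 3; 5]);
        ([:: 0; 1; 4; 5], [:: 2; 3; 4; 5])]].

(* Rows Y1 Y2, Y1 Y3, Y2 Y3, Z1, Z2, Z1 Z2 W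
   and Y1, Y2, Y3, Z1 Z2, Z1 W, Z2 W, where W = Y1 Y2 Y3. *)
Definition family3 : seq column :=
  zero 6 :: [seq (indicator c.1, indicator c.2) | c <-
    [:: ([:: 3; 5], [:: 3; 4]);
        ([:: 4; 5], [:: 3; 5]);
        ([:: 0; 1; 5], [:: 0; 4; 5]);
        ([:: 0; 2; 5], [:: 1; 4; 5]);
        ([:: 1; 2; 5], [:: 2; 4; 5])]].

(* Rows X Z1, X Z2, X Z3, Y1, Y2, Y3 and Z1, Z2, Z3, X Y1, X Y2, X Y3. *)
Definition family4 : seq column :=
  zero 6 :: (indicator [:: 0; 1; 2], indicator [:: 3; 4; 5])
    :: [seq (x, x) | x <- bitseqs 6 & (count id x == 2) && crossing x].

Definition families : seq (seq column) :=
  [:: family1; family2; family3; family4].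

(** With no targets [embeddable] is false, so success excludes every family for n = 5. *)
Lemma search5 : search 7 5 [::] (columns 5) [:: zero 5].
Proof. by vm_cast_no_check (erefl true). Qed.

Lemma search6 : search 8 6 families (columns 6) [:: zero 6].
Proof. by vm_cast_no_check (erefl true). Qed.

(** * Trades as lists of blocks *)

Section Columns.
Variable V : finType.
Implicit Types (p q : seq {set V}) (T : legs V) (A B S : {set V}) (v w : V).

Definition col p q v : column :=
  ([seq v \in B | B <- p], [seq v \in B | B <- q]).

Lemma col_relabel s t p q v :
  (forall i, i \in s -> i < size p) -> (forall i, i \in t -> i < size q) ->
  col [seq nth set0 p i | i <- s] [seq nth set0 q i | i <- t] v
    = relabel s t (col p q v).
Proof.
move=> sp tq; rewrite /col /relabel /reorder -!map_comp; congr (_, _).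
  by apply/eq_in_map => i /sp ilt /=; rewrite (nth_map set0).
by apply/eq_in_map => i /tq ilt /=; rewrite (nth_map set0).
Qed.

(** The empty set gives equal sizes, and the balance conditions cover the singletons (v = w) and the
    pairs (v different from w). *)
Lemma is_trade2P p q : is_trade 2 (seq_mset p, seq_mset q) <->
  [/\ size p = size q, forall v w, balanced (col p q v) (col p q w)
    & forall B, B \in p -> B \notin q].
Proof.
have countE a (s : seq {set V}) : count a (seq_mset s) = count a s.
  exact/seq.permP/perm_eq_seq_mset.
have ovE v w : balanced (col p q v) (col p q w) =
    (count (fun B => [set v; w] \subset B) p ==
     count (fun B => [set v; w] \subset B) q).
  rewrite /balanced !overlap_map.
  by congr (_ == _); apply: eq_count => B; rewrite subUset !sub1set.
have djE : mdisjoint (seq_mset p) (seq_mset q) <->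
    forall B, B \in p -> B \notin q.
  have memE B (s : seq {set V}) : (B \in seq_mset s) = (B \in s).
    exact/perm_mem/perm_eq_seq_mset.
  rewrite /mdisjoint; split=> [/eqP dj B Bp|dj].
    apply/negP=> Bq; have := in_mset0 B.
    by rewrite -dj in_msetI !memE Bp Bq.
  have [->|[B]] := mset_0Vmem (msetI (seq_mset p) (seq_mset q)); first exact: eqxx.
  by rewrite in_msetI !memE => /andP[/dj/negP].
split=> [[/djE dj tr]|[sz bal /djE dj]].
  split=> // [|v w].
    have := tr 0 isT set0 (cards0 V); rewrite !countE.
    by rewrite !(eq_count (a2 := predT)) ?count_predT // => B; apply: sub0set.
  rewrite ovE -[X in X == _]countE -[X in _ == X]countE; apply/eqP.
  by apply: tr (erefl _); rewrite cards2; case: (v != w).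
split=> // i i2 A Ai; rewrite /= !countE.
case: i i2 Ai => [|[|[|//]]] _.
- move/cards0_eq->.
  by rewrite !(eq_count (a2 := predT)) ?count_predT // => B; apply: sub0set.
- move/eqP/cards1P => [v ->]; rewrite -[[set v]]setUid.
  by apply/eqP; rewrite -ovE.
- by move/eqP/cards2P => [v [w [_ ->]]]; apply/eqP; rewrite -ovE.
Qed.

Lemma normal_form k n targets p q :
    search k n targets (columns n) [:: zero n] ->
    size p = n -> size q = n -> is_trade 2 (seq_mset p, seq_mset q) ->
  exists p' q' U, [/\ perm_eq p' p, perm_eq q' q, U \in targets
                    & forall v, col p' q' v \in closure U].
Proof.
move=> srch pn qn /is_trade2P[_ bal dj].
(* The zero column, balanced with all others, is added because the search starts from it. *)
set L := zero n :: [seq col p q v | v <- enum V].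
have colL v : col p q v \in L by rewrite inE map_f ?orbT ?mem_enum.
have ov0 m x : overlap (nseq m false) x = 0.
  by rewrite /overlap; elim: m x => [|m IHm] [|b x] //=; apply: IHm.
have famL : is_family n (closure L).
  apply: closure_family => [c|c d|i j].
  - by rewrite inE => /predU1P[->|/mapP[v _ ->]]; rewrite ?size_nseq ?size_map.
  - rewrite !inE => /predU1P[->|/mapP[v _ ->]] /predU1P[->|/mapP[w _ ->]].
    + by rewrite /balanced !ov0.
    + by rewrite /balanced !ov0.
    + by rewrite balancedC /balanced !ov0.
    + exact: bal.
  rewrite -{1}pn -qn => ilt jlt.
  have /existsP[v vij] :
      [exists v, (v \in nth set0 p i) != (v \in nth set0 q j)].
    apply: contraR (dj _ (mem_nth set0 ilt)); rewrite negb_exists => /forallP e.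
    rewrite (_ : nth set0 p i = nth set0 q j) ?mem_nth //.
    by apply/setP=> v; apply/eqP; rewrite -[_ == _]negbK.
  by exists (col p q v); rewrite //= !(nth_map set0).
have [|s [t [U [sP tP UT LU]]]] := search_sound srch famL.
  by move=> c; rewrite inE => /eqP->; rewrite mem_cat mem_head.
exists [seq nth set0 p i | i <- s], [seq nth set0 q i | i <- t], U.
have permE r u : perm_eq u (iota 0 n) -> size r = n ->
    perm_eq [seq nth set0 r i | i <- u] r.
  move=> uP rn; apply: perm_trans (perm_map _ uP) _.
  by rewrite -rn -/(mkseq _ _) mkseq_nth.
split; rewrite ?permE // => v; rewrite col_relabel.
- by apply: LU; rewrite mem_cat colL.
- by move=> i; rewrite pn; apply: perm_iota_lt.
- by move=> i; rewrite qn; apply: perm_iota_lt.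
Qed.

Lemma col_shift S p q v :
  col (map (symdiff S) p) (map (symdiff S) q) v
    = if v \in S then compl (col p q v) else col p q v.
Proof.
rewrite /col /compl /= -!map_comp; case: ifP => vS; congr (_, _);
  by apply: eq_map => B /=; rewrite in_symdiff vS.
Qed.

(** The set S collects the points whose column is outside U, so shifting by S complements exactly
    the columns that need it. *)
Lemma col_shift_closure (U : seq column) p q v (S := [set v | col p q v \notin U]) :
  col p q v \in closure U ->
  col (map (symdiff S) p) (map (symdiff S) q) v \in U.
Proof.
rewrite col_shift in_set mem_cat; case: (boolP (col p q v \in U)) => //= _.
by case/mapP=> c cU ->; rewrite complK.
Qed.

Lemma shift_seq S p q : shift S (seq_mset p, seq_mset q)
  = (seq_mset (map (symdiff S) p), seq_mset (map (symdiff S) q)).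
Proof.
rewrite /shift /map_blocks /=; congr (_, _);
  by apply/eq_seq_msetP/perm_map/perm_eq_seq_mset.
Qed.

Lemma is_trade2_columns (U : seq column) p q : {in U &, forall c d, balanced c d} ->
  (forall v, col p q v \in U) -> size p = size q ->
  (forall B, B \in p -> B \notin q) -> is_trade 2 (seq_mset p, seq_mset q).
Proof. by move=> bal colU pq dj; apply/is_trade2P; split=> // v w; apply: bal. Qed.

Lemma gring_of_seq p q : gring_of (seq_mset p, seq_mset q)
  = (\sum_(B <- p) gset B - \sum_(B <- q) gset B)%R.
Proof.
have sumE s : (\sum_(X : {set V}) gset X *~ (seq_mset s X)%:Z
               = \sum_(B <- s) gset B)%R.
  transitivity (\sum_(X : {set V}) gset X *+ count_mem X s)%R.
    by apply: eq_bigr => X _; rewrite mset_seqE.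
  elim: s => [|B s IHs]; first by rewrite big_nil big1.
  rewrite big_cons -IHs.
  under eq_bigr => X _ do rewrite /= mulrnDr.
  rewrite big_split (bigD1 B) //= eqxx big1 ?addr0 // => X /negbTE.
  by rewrite eq_sym => ->.
rewrite /gring_of -!sumE -sumrB.
by apply: eq_bigr => X _; rewrite mulrzBr.
Qed.

End Columns.

(** * Reading off the forms *)

Section Forms.
Variable V : finType.
Implicit Types (A B : {set V}) (v : V).

Lemma symdiff0r A : A :+: set0 = A.
Proof. by rewrite symdiffC symdiff0l. Qed.

Lemma mutually_disjoint_uniq (s : seq {set V}) :
  mutually_disjoint s -> nonempty_sets s -> uniq s.
Proof.
rewrite /mutually_disjoint /nonempty_sets.
elim: s => //= A s IHs /andP[/allP dA ds]; rewrite inE negb_or eq_sym.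
case/andP=> A0 s0; rewrite IHs // andbT; apply: contra A0 => /dA.
by rewrite -setI_eq0 setIid.
Qed.

Lemma mutually_disjoint_uniq_cat (s t : seq {set V}) :
  mutually_disjoint s -> mutually_disjoint t -> nonempty_sets (s ++ t) ->
  (forall B, B \in t -> B \notin s) -> uniq (s ++ t).
Proof.
rewrite /nonempty_sets mem_cat negb_or => ds dt /andP[s0 t0] st.
rewrite cat_uniq !mutually_disjoint_uniq //= andbT.
by apply/hasPn => B /st.
Qed.

Variables (p0 p1 p2 p3 p4 p5 q0 q1 q2 q3 q4 q5 : {set V}).
Let p := [:: p0; p1; p2; p3; p4; p5].
Let q := [:: q0; q1; q2; q3; q4; q5].
Hypothesis dj : forall B, B \in p -> B \notin q.

(** A Boolean relation between the memberships of a point in the twelve blocks needs checking only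
    on the finite list U. *)
Lemma columnwise (U : seq column) (Q : bool -> bool -> bool -> bool -> bool ->
    bool -> bool -> bool -> bool -> bool -> bool -> bool -> bool) :
  (forall v, col p q v \in U) ->
  all (fun c => let x := nth false c.1 in let y := nth false c.2 in
       Q (x 0) (x 1) (x 2) (x 3) (x 4) (x 5) (y 0) (y 1) (y 2) (y 3) (y 4) (y 5)) U ->
  forall v, Q (v \in p0) (v \in p1) (v \in p2) (v \in p3) (v \in p4) (v \in p5)
              (v \in q0) (v \in q1) (v \in q2) (v \in q3) (v \in q4) (v \in q5).
Proof. by move=> colU /allP QU v; apply: (QU _ (colU v)). Qed.

Lemma block_neq i j : i < 6 -> j < 6 -> nth set0 p i != nth set0 q j.
Proof.
move=> ilt jlt; apply: contraNneq (dj (mem_nth set0 (ilt : i < size p))) => ->.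
exact: mem_nth.
Qed.

(** Set equalities and disjointness become pointwise Boolean relations, abstracted over the twelve
    memberships and evaluated on U. *)
Ltac by_columns colU :=
  let v := fresh "v" in
  rewrite -?setI_eq0; try (lazymatch goal with |- _ = _ => apply/eqP end);
  apply/eqP/setP => v;
  rewrite ?(in_symdiff, in_setI, in_setD, in_set0); apply/eqP;
  match goal with |- is_true ?e =>
    let e' := eval pattern (v \in p0), (v \in p1), (v \in p2), (v \in p3),
      (v \in p4), (v \in p5), (v \in q0), (v \in q1), (v \in q2), (v \in q3),
      (v \in q4), (v \in q5) in e in
    match e' with ?Q _ _ _ _ _ _ _ _ _ _ _ _ =>
      exact: (columnwise (Q := Q) colU isT v)
    end
  end.


Ltac disjoint_by_columns colU :=
  rewrite /mutually_disjoint /=; do !(apply/andP; split=> //); by_columns colU.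

Lemma family2_form : (forall v, col p q v \in family2) ->
  form2 (seq_mset p, seq_mset q).
Proof.
move=> colU.
have e0 : p0 = q0 :+: q2 by by_columns colU.
have e1 : p1 = q1 :+: q2 by by_columns colU.
have e5 : p5 = p2 :+: p3 :+: p4 by by_columns colU.
have e3' : q3 = q0 :+: q1 :+: q2 by by_columns colU.
have e4' : q4 = p2 :+: p4 by by_columns colU.
have e5' : q5 = p3 :+: p4 by by_columns colU.
have e : q0 :+: q1 = p2 :+: p3 by by_columns colU.
have dY : mutually_disjoint [:: q0; q1; q2] by disjoint_by_columns colU.
have dZ : mutually_disjoint [:: p2; p3; p4] by disjoint_by_columns colU.
(* An empty set among the six would make two blocks of opposite legs coincide. *)
have nY0 : q0 != set0.
  by apply: contraNneq (@block_neq 0 2 isT isT) => /= q00; rewrite e0 q00 symdiff0l.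
have nY1 : q1 != set0.
  by apply: contraNneq (@block_neq 1 2 isT isT) => /= q10; rewrite e1 q10 symdiff0l.
have nY2 : q2 != set0.
  by apply: contraNneq (@block_neq 0 0 isT isT) => /= q20; rewrite e0 q20 symdiff0r.
have nZ0 : p2 != set0.
  by apply: contraNneq (@block_neq 4 4 isT isT) => /= p20; rewrite e4' p20 symdiff0l.
have nZ1 : p3 != set0.
  by apply: contraNneq (@block_neq 4 5 isT isT) => /= p30; rewrite e5' p30 symdiff0l.
have nZ2 : p4 != set0.
  by apply: contraNneq (@block_neq 2 4 isT isT) => /= p40; rewrite e4' p40 symdiff0r.
have n0 : nonempty_sets [:: q0; q1; q2; p2; p3; p4].
  by rewrite /nonempty_sets !inE !negb_or ![set0 == _]eq_sym nY0 nY1 nY2 nZ0 nZ1.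
exists q0, q1, q2, p2, p3, p4; split; first split=> //.
- apply: (@mutually_disjoint_uniq_cat [:: q0; q1; q2] [:: p2; p3; p4]) => // B Bp.
  have: B \notin q.
    apply: dj; rewrite -[p]/([:: p0; p1] ++ [:: p2; p3; p4] ++ [:: p5]).
    by rewrite !mem_cat Bp orbT.
  by rewrite -[q]/([:: q0; q1; q2] ++ [:: q3; q4; q5]) mem_cat negb_or => /andP[].
(* In the group ring this relation cancels Y1 Y2 against Z1 Z2. *)
have {}e : (gset q0 * gset q1 = gset p2 * gset p3)%R by rewrite !gsetM e.
rewrite gring_of_seq !big_cons !big_nil e0 e1 e5 e3' e4' e5' -!gsetM e.
move: (gset q0) (gset q1) (gset q2) (gset p2) (gset p3) (gset p4) e.
by move=> y0 y1 y2 z0 z1 z2 e; ring: e.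
Qed.

Lemma family3_form : (forall v, col p q v \in family3) ->
  form3 (seq_mset p, seq_mset q).
Proof.
move=> colU.
have e0 : p0 = q0 :+: q1 by by_columns colU.
have e1 : p1 = q0 :+: q2 by by_columns colU.
have e2 : p2 = q1 :+: q2 by by_columns colU.
have e5 : p5 = p3 :+: p4 :+: (q0 :+: q1 :+: q2) by by_columns colU.
have e3' : q3 = p3 :+: p4 by by_columns colU.
have e4' : q4 = p3 :+: (q0 :+: q1 :+: q2) by by_columns colU.
have e5' : q5 = p4 :+: (q0 :+: q1 :+: q2) by by_columns colU.
exists q0, q1, q2, p3, p4; split.
- by disjoint_by_columns colU.
- rewrite /nonempty_sets !inE !negb_or ![set0 == _]eq_sym.
  apply/and5P; split.
  + by apply: contraNneq (@block_neq 0 1 isT isT) => /= q00; rewrite e0 q00 symdiff0l.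
  + by apply: contraNneq (@block_neq 0 0 isT isT) => /= q10; rewrite e0 q10 symdiff0r.
  + by apply: contraNneq (@block_neq 1 0 isT isT) => /= q20; rewrite e1 q20 symdiff0r.
  + by apply: contraNneq (@block_neq 4 3 isT isT) => /= p30; rewrite e3' p30 symdiff0l.
  + by apply: contraNneq (@block_neq 3 3 isT isT) => /= p40; rewrite e3' p40 symdiff0r.
(* The terms 1 and Y1 Y2 Y3 occur in both products and cancel. *)
rewrite gring_of_seq !big_cons !big_nil e0 e1 e2 e5 e3' e4' e5' -!gsetM.
move: (gset q0) (gset q1) (gset q2) (gset p3) (gset p4) => y0 y1 y2 z0 z1.
ring.
Qed.

Lemma family4_form : (forall v, col p q v \in family4) ->
  form4 (seq_mset p, seq_mset q).
Proof.
move=> colU.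
(* In [family4] the i-th blocks of the two legs differ by the same set for every i. *)
set X := p0 :+: q0.
have e0 : p0 = X :+: q0 by rewrite /X; by_columns colU.
have e1 : p1 = X :+: q1 by rewrite /X; by_columns colU.
have e2 : p2 = X :+: q2 by rewrite /X; by_columns colU.
have e3' : q3 = X :+: p3 by rewrite /X; by_columns colU.
have e4' : q4 = X :+: p4 by rewrite /X; by_columns colU.
have e5' : q5 = X :+: p5 by rewrite /X; by_columns colU.
exists X, p3, p4, p5, q0, q1, q2; split.
  split.
  - by rewrite /X; disjoint_by_columns colU.
  - by rewrite /X; disjoint_by_columns colU.
  - by by_columns colU.
  - move=> Y Z Yp Zq YZ; have /negP[] : Y \notin q.
      by apply: dj; move: Yp; rewrite !inE => /or3P[]->; rewrite ?orbT.
    by rewrite YZ; move: Zq; rewrite !inE => /or3P[]->; rewrite ?orbT.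
  - move=> X0; have := @block_neq 0 0 isT isT.
    by rewrite /= e0 X0 symdiff0l eqxx.
congr (_, _); apply/eq_seq_msetP.
  rewrite -e0 -e1 -e2.
  by rewrite -[p]/([:: p0; p1; p2] ++ [:: p3; p4; p5]) perm_catC.
by rewrite -e3' -e4' -e5'.
Qed.

(* The form requires the Y's and Z's to be nonempty; for the Y's and Z's read
   off here this can fail unless X is empty or every column occurs. *)
Lemma family1_form : (forall v, col p q v \in family1) ->
    (forall v, col p q v != column_X)
    \/ {in splits1, forall c, exists v, col p q v = c} ->
  form1 (seq_mset p, seq_mset q).
Proof.
move=> colU full.
(* Only [column_X] has more than one true entry in the first three rows of p, or in the last three
   of q. Hence X is an intersection of two blocks, and differences recover the Y's and Z's. *)
set X := p0 :&: p1.
set Y0 := q3 :\: q4; set Y1 := q4 :\: q3; set Y2 := q5 :\: q4.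
set Z0 := p0 :\: p1; set Z1 := p1 :\: p0; set Z2 := p2 :\: p1.
have e0 : p0 = X :+: Z0 by rewrite /X /Z0; by_columns colU.
have e1 : p1 = X :+: Z1 by rewrite /X /Z1; by_columns colU.
have e2 : p2 = X :+: Z2 by rewrite /X /Z2; by_columns colU.
have e3 : p3 = Y1 :+: Y2 by rewrite /Y1 /Y2; by_columns colU.
have e4 : p4 = Y0 :+: Y2 by rewrite /Y0 /Y2; by_columns colU.
have e5 : p5 = Y0 :+: Y1 by rewrite /Y0 /Y1; by_columns colU.
have e0' : q0 = Z1 :+: Z2 by rewrite /Z1 /Z2; by_columns colU.
have e1' : q1 = Z0 :+: Z2 by rewrite /Z0 /Z2; by_columns colU.
have e2' : q2 = Z0 :+: Z1 by rewrite /Z0 /Z1; by_columns colU.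
have e3' : q3 = X :+: Y0 by rewrite /X /Y0; by_columns colU.
have e4' : q4 = X :+: Y1 by rewrite /X /Y1; by_columns colU.
have e5' : q5 = X :+: Y2 by rewrite /X /Y2; by_columns colU.
have e : Y0 :+: Y1 :+: Y2 = Z0 :+: Z1 :+: Z2.
  by rewrite /Y0 /Y1 /Y2 /Z0 /Z1 /Z2; by_columns colU.
have dY : mutually_disjoint [:: X; Y0; Y1; Y2].
  by rewrite /X /Y0 /Y1 /Y2; disjoint_by_columns colU.
have dZ : mutually_disjoint [:: X; Z0; Z1; Z2].
  by rewrite /X /Z0 /Z1 /Z2; disjoint_by_columns colU.
have nYZ B : B \in [:: Z0; Z1; Z2] -> B \notin [:: Y0; Y1; Y2].
  (* Adding X turns the Z's into blocks of p and the Y's into blocks of q. *)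
  move=> BZ; have: X :+: B \notin q.
    apply: dj; move: BZ; rewrite !inE => /or3P[]/eqP->;
      by rewrite -?e0 -?e1 -?e2 eqxx ?orbT.
  apply: contra; rewrite !inE => /or3P[]/eqP->;
    by rewrite -?e3' -?e4' -?e5' eqxx ?orbT.
have n0 : nonempty_sets [:: Y0; Y1; Y2; Z0; Z1; Z2].
  rewrite /nonempty_sets !inE !negb_or ![set0 == _]eq_sym.
  case: full => full.
    have X0 : X = set0.
      apply/setP=> v; rewrite in_setI in_set0; apply: contraNF (full v).
      pose hd c := c == column_X.
      have /allP/(_ _ (colU v))/implyP : all (fun c =>
          nth false c.1 0 && nth false c.1 1 ==> hd c) family1 by [].
      exact.
    do 5?[apply/andP; split].
    - apply: contraNneq (@block_neq 4 5 isT isT) => /= E.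
      by rewrite e4 e5' X0 E !symdiff0l.
    - apply: contraNneq (@block_neq 3 5 isT isT) => /= E.
      by rewrite e3 e5' X0 E !symdiff0l.
    - apply: contraNneq (@block_neq 3 4 isT isT) => /= E.
      by rewrite e3 e4' X0 E symdiff0l symdiff0r.
    - apply: contraNneq (@block_neq 2 1 isT isT) => /= E.
      by rewrite e2 e1' X0 E !symdiff0l.
    - apply: contraNneq (@block_neq 2 0 isT isT) => /= E.
      by rewrite e2 e0' X0 E !symdiff0l.
    - apply: contraNneq (@block_neq 1 0 isT isT) => /= E.
      by rewrite e1 e0' X0 E symdiff0l symdiff0r.
  (* If every split occurs, each Y and Z contains a point with a suitable column. *)
  have inh x (A : {set V}) (P : pred column) : (x, map negb x) \in splits1 ->
      P (x, map negb x) -> (forall v, P (col p q v) -> v \in A) -> A != set0.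
    by move=> /full[v vE] Px PA; apply/set0Pn; exists v; apply: PA; rewrite vE.
  pose P i j (c : column) := (nth false c.1 i) && ~~ (nth false c.1 j).
  pose P' i j (c : column) := (nth false c.2 i) && ~~ (nth false c.2 j).
  do 5?[apply/andP; split].
  - apply: (inh (indicator [:: 0; 4; 5]) _ (P' 3 4)) => // v; by rewrite in_setD andbC.
  - apply: (inh (indicator [:: 0; 3; 5]) _ (P' 4 3)) => // v; by rewrite in_setD andbC.
  - apply: (inh (indicator [:: 0; 3; 4]) _ (P' 5 4)) => // v; by rewrite in_setD andbC.
  - apply: (inh (indicator [:: 0; 4; 5]) _ (P 0 1)) => // v; by rewrite in_setD andbC.
  - apply: (inh (indicator [:: 1; 4; 5]) _ (P 1 0)) => // v; by rewrite in_setD andbC.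
  - apply: (inh (indicator [:: 2; 4; 5]) _ (P 2 1)) => // v; by rewrite in_setD andbC.
exists X, Y0, Y1, Y2, Z0, Z1, Z2; split; first split=> //.
  apply: (@mutually_disjoint_uniq_cat [:: Y0; Y1; Y2] [:: Z0; Z1; Z2]) => //.
    by case/andP: dY.
  by case/andP: dZ.
have {}e : (gset Y0 * gset Y1 * gset Y2 = gset Z0 * gset Z1 * gset Z2)%R.
  by rewrite !gsetM e.
(* This reduces the powers of X; the relation [e] then cancels the cubic terms. *)
have XX : (gset X * gset X = 1)%R by rewrite gsetM symdiffvv.
rewrite gring_of_seq !big_cons !big_nil e0 e1 e2 e3 e4 e5.
rewrite e0' e1' e2' e3' e4' e5' -!gsetM.
move: (gset X) (gset Y0) (gset Y1) (gset Y2) (gset Z0) (gset Z1) (gset Z2) e XX.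
move=> x y0 y1 y2 z0 z1 z2 e XX; ring: e XX.
Qed.

End Forms.

(** * Shifting a trade into a maximal family *)

Section Assembly.
Variable V : finType.
Implicit Types (p q : seq {set V}) (v : V).

(* The stabiliser of [family1] acts transitively on [splits1], so an
   unused column can be moved to the first place. *)
Lemma family1_recenter p q : size p = 6 -> size q = 6 ->
    (forall v, col p q v \in closure family1) ->
  exists p' q', [/\ perm_eq p' p, perm_eq q' q,
    forall v, col p' q' v \in closure family1 &
    (forall v, col p' q' v \notin [:: column_X; compl column_X])
    \/ {in splits1, forall c, exists v, col p' q' v \in [:: c; compl c]}].
Proof.
move=> p6 q6 colU.
have [/allP full|/allPn[c cR /existsPn unused]] := boolP (all
    (fun c => [exists v, col p q v \in [:: c; compl c]]) splits1).
  by exists p, q; split=> //; right=> c /full/existsP.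
(* Sorting puts the true entries of [c.1] first and so moves c to [column_X]. As [c.2] is the
   negation of [c.1], one permutation serves both legs. *)
pose s := row_order 6 [:: c.1].
have sP : perm_eq s (iota 0 6) by apply: perm_row_order.
have permE r : size r = 6 -> perm_eq [seq nth set0 r i | i <- s] r.
  move=> r6; apply: perm_trans (perm_map _ sP) _.
  by rewrite -r6 -/(mkseq _ _) mkseq_nth.
have colE v : col [seq nth set0 p i | i <- s] [seq nth set0 q i | i <- s] v
              = relabel s s (col p q v).
  by apply: col_relabel => i; rewrite ?p6 ?q6; apply: perm_iota_lt.
have /allP/(_ c cR)/allP sU : all (fun c => let s := row_order 6 [:: c.1] in
    all (fun d => (relabel s s d \in closure family1) &&
      ((relabel s s d \in [:: column_X; compl column_X])
         ==> (d \in [:: c; compl c])))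
    (closure family1)) splits1 by vm_compute.
exists [seq nth set0 p i | i <- s], [seq nth set0 q i | i <- s].
split; [exact: permE | exact: permE | move=> v | left=> v].
  by rewrite colE; have /andP[] := sU _ (colU v).
 rewrite colE; have /andP[_ /implyP imp] := sU _ (colU v).
exact: contra (unused v).
Qed.

Lemma families_balanced U : U \in families -> {in U &, forall c d, balanced c d}.
Proof.
have /allP bal : all (fun U => all (fun c => all (balanced c) U) U) families.
  by vm_compute.
by move=> /bal/allP balU c d /balU/allP; apply.
Qed.

Lemma shift_to_family T p q U (S := [set v | col p q v \notin U])
    (T' := (seq_mset (map (symdiff S) p), seq_mset (map (symdiff S) q)) : legs V) :
    U \in families -> is_trade 2 T -> volume T = 6 ->
    perm_eq p T.1 -> perm_eq q T.2 -> (forall v, col p q v \in closure U) ->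
  [/\ equivalent T T', is_trade 2 T' & volume T' = 6].
Proof.
move=> UF trT volT pP qP colU.
have TE : T = (seq_mset p, seq_mset q).
  case: T pP qP {trT volT T'} => T1 T2 /= /eq_seq_msetP-> /eq_seq_msetP->.
  by rewrite !seq_mset_id.
rewrite TE in trT; have /is_trade2P[pq _ dj] := trT.
split.
- by have := equivalent_shift S T; rewrite {2}TE shift_seq.
- apply: (is_trade2_columns (families_balanced UF)).
  + by move=> v; apply: col_shift_closure.
  + by rewrite !size_map.
  + move=> _ /mapP[B Bp ->]; rewrite (mem_map (can_inj (symdiffKl S))).
    exact: dj.
- by rewrite /volume /= (perm_size (perm_eq_seq_mset _)) size_map (perm_size pP).
Qed.

(** The shifted columns lie in [family1], which contains no complement of a split, so occurrence up
    to complement becomes occurrence. *)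
Lemma shift_recentered p q (S := [set v | col p q v \notin family1])
    (p' := map (symdiff S) p) (q' := map (symdiff S) q) :
    (forall v, col p q v \in closure family1) ->
    (forall v, col p q v \notin [:: column_X; compl column_X])
    \/ {in splits1, forall c, exists v, col p q v \in [:: c; compl c]} ->
  (forall v, col p' q' v != column_X)
  \/ {in splits1, forall c, exists v, col p' q' v = c}.
Proof.
move=> colU [unused|full]; [left=> v | right=> c cR].
  apply: contra (unused v); rewrite col_shift !inE.
  by case: ifP => _ /eqP <-; rewrite ?complK eqxx ?orbT.
have [v vc] := full c cR; exists v.
have /allP/(_ c cR) c'U : all (fun c => compl c \notin family1) splits1.
  by vm_compute.
have : col p' q' v \in [:: c; compl c].
  rewrite col_shift; case: ifP => // _; move: vc; rewrite !inE.
  by case/orP=> /eqP->; rewrite ?complK eqxx ?orbT.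
rewrite !inE => /orP[/eqP//|/eqP vc'].
by have := col_shift_closure (colU v); rewrite -/S vc' (negbTE c'U).
Qed.

Lemma size6P (T : Type) (s : seq T) : size s = 6 ->
  exists x0 x1 x2 x3 x4 x5, s = [:: x0; x1; x2; x3; x4; x5].
Proof.
case: s => [|x0 [|x1 [|x2 [|x3 [|x4 [|x5 [|]]]]]]] // _.
by exists x0, x1, x2, x3, x4, x5.
Qed.

End Assembly.

Theorem theorem6p7 (V : finType) (T : legs V)
    (trade_T : is_trade 2 T) (volume_T : volume T = 5 \/ volume T = 6) :
  exists T' : legs V,
    [/\ equivalent T T', is_trade 2 T', volume T' = 6 &
        [\/ form1 T', form2 T', form3 T' | form4 T']].
Proof.
have trT : is_trade 2 (seq_mset T.1, seq_mset T.2).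
  by rewrite !seq_mset_id; case: T trade_T {volume_T}.
have size2 : size T.2 = volume T by have /is_trade2P[] := trT.
case: volume_T => volT; rewrite volT in size2.
  (* Volume 5 is contradictory: U would belong to an empty list. *)
  by have [? [? [U []]]] := normal_form search5 volT size2 trT.
have [p [q [U [pP qP UF colU]]]] := normal_form search6 volT size2 trT.
(* The common end of the four cases: shift into the family, name the twelve blocks and read off the
   form. *)
have finish U' p' q' : U' \in families -> perm_eq p' T.1 -> perm_eq q' T.2 ->
    (forall v, col p' q' v \in closure U') ->
    (forall p0 p1 p2 p3 p4 p5 q0 q1 q2 q3 q4 q5 : {set V},
       let S := [set v | col p' q' v \notin U'] in
       let p := [:: p0; p1; p2; p3; p4; p5] in
       let q := [:: q0; q1; q2; q3; q4; q5] in
       p = map (symdiff S) p' -> q = map (symdiff S) q' ->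
       (forall B, B \in p -> B \notin q) -> (forall v, col p q v \in U') ->
       let T' := (seq_mset p, seq_mset q) in
       [\/ form1 T', form2 T', form3 T' | form4 T']) ->
    exists T', [/\ equivalent T T', is_trade 2 T', volume T' = 6 &
        [\/ form1 T', form2 T', form3 T' | form4 T']].
  move=> U'F p'P q'P colU' formT.
  have [eqT trT' volT'] := shift_to_family U'F trade_T volT p'P q'P colU'.
  eexists; split; [exact: eqT | exact: trT' | exact: volT' |].
  set S := [set v | _] in trT' *; have /is_trade2P[_ _ dj] := trT'.
  have colS v : col (map (symdiff S) p') (map (symdiff S) q') v \in U'.
    exact: col_shift_closure.
  have := erefl (map (symdiff S) p'); have := erefl (map (symdiff S) q').
  have /size6P : size (map (symdiff S) p') = 6 by rewrite size_map (perm_size p'P).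
  have /size6P : size (map (symdiff S) q') = 6 by rewrite size_map (perm_size q'P).
  move=> [q0 [q1 [q2 [q3 [q4 [q5 qE]]]]]] [p0 [p1 [p2 [p3 [p4 [p5 pE]]]]]] _ _.
  rewrite pE qE in dj colS *; exact: formT.
move: UF; rewrite !inE => /or4P[]/eqP UE; rewrite {U}UE in colU.
- have p6 : size p = 6 by rewrite (perm_size pP).
  have q6 : size q = 6 by rewrite (perm_size qP).
  have [p' [q' [p'P q'P colU' full]]] := family1_recenter p6 q6 colU.
  apply: (finish family1 p' q') => //.
  + exact: perm_trans p'P pP.
  + exact: perm_trans q'P qP.
  + move=> p0 p1 p2 p3 p4 p5 q0 q1 q2 q3 q4 q5 S p'' q'' pE qE dj colS T'.
    apply: Or41; apply: family1_form => //.
    by have := shift_recentered colU' full; rewrite -/S -pE -qE.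
- apply: (finish family2 p q) => // *.
  by apply: Or42; apply: family2_form.
- apply: (finish family3 p q) => // *.
  by apply: Or43; apply: family3_form.
- apply: (finish family4 p q) => // *.
  by apply: Or44; apply: family4_form.
Qed.
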